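(* Let $\kappa>0$, $\rho>0$, $\delta>0$ and $0<\alpha<1$, and for $\xi>0$ let $$\omega(\xi)=\left(\frac{4\pi\kappa}{\rho\,\delta^{2\alpha}}\int_0^1\frac{1-J_0(\xi\delta z)}{z^{1+2\alpha}}\,dz\right)^{1/2},$$ where $J_0$ is the $0$-th order Bessel function of the first kind. Then $$\lim_{\xi\to0}\xi^{-2}\omega^2(\xi)=\frac{\pi\kappa\,\delta^{2(1-\alpha)}}{2(1-\alpha)\,\rho}$$ and $$\lim_{\xi\to\infty}\xi^{-2\alpha}\omega^2(\xi)=\frac{4\pi\kappa}{\rho}\int_0^\infty\frac{1-J_0(\tau)}{\tau^{1+2\alpha}}\,d\tau.$$
   Context: $J_0(x)=\sum_{m=0}^\infty\frac{(-1)^m}{(m!)^2}\left(\frac x2\right)^{2m}$. The function $\omega$ is the dispersion relation of the two-dimensional linear peridynamic equation. *)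

(* Defs.v *)
From mathcomp Require Import all_boot all_order all_algebra.
From mathcomp Require Import all_classical all_reals all_analysis.
Set Implicit Arguments.
Unset Strict Implicit.
Unset Printing Implicit Defensive.
Import Order.TTheory GRing.Theory Num.Theory.
Import numFieldNormedType.Exports.
Local Open Scope classical_set_scope.
Local Open Scope ring_scope.

Definition besselJ0 (R : realType) (x : R) : R :=
  limn (series (fun m : nat =>
    (-1) ^+ m / (m`!%:R) ^+ 2 * (x / 2) ^+ (2 * m))).

(* The integrand is singular at z = 0 (where powR and division by 0 return
   junk values), so the integral is taken over the half-open interval. *)
Definition omega (R : realType) (kappa rho delta alpha xi : R) : R :=
  Num.sqrt (4 * pi * kappa / (rho * delta `^ (2 * alpha)) *
    \int[lebesgue_measure]_(z in `]0, 1])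
      ((1 - besselJ0 (xi * delta * z)) / z `^ (1 + 2 * alpha))).

(* Main.v *)
(* Write [J0 x = g (x^2/4)] with [g t = sum_m (-t)^m/(m!)^2], an entire function
   solving [t g'' + g' + g = 0].  On [t >= 0] the energy [g^2 + t g'^2] has
   derivative [- g'^2], so [|g| <= 1]; then [(t g')' = - g] gives
   [-1 <= g' <= t - 1], hence [t - t^2 <= 1 - g t <= t].  Thus [0 <= 1 - J0 <= 2]
   and [x^2/4 - x^4/16 <= 1 - J0 x <= x^2/4].

   With [c = xi * delta], the change of variables [tau = c * z] turns the integral
   defining [omega] into [c^(2 alpha) * H c], where [H c] integrates
   [(1 - J0 tau)/tau^(1+2 alpha)] over [0 < tau <= c].  The two-sided bound on
   [1 - J0] squeezes [H c / c^(2-2 alpha)] as [c] tends to 0, and the bound by 2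
   controls the tail of the integral by [c^(-2 alpha)/alpha] as [c] tends to
   infinity. *)
Require Import Defs.
From mathcomp Require Import all_boot all_order all_algebra.
From mathcomp Require Import all_classical all_reals all_analysis.
From mathcomp Require Import measurable_realfun ring lra.
Set Implicit Arguments.
Unset Strict Implicit.
Unset Printing Implicit Defensive.
Import Order.TTheory GRing.Theory Num.Theory.
Import numFieldNormedType.Exports.
Local Open Scope classical_set_scope.
Local Open Scope ring_scope.

Lemma is_derive_continuous (R : realType) (f : R -> R) (x l : R) :
  is_derive x 1 f l -> {for x, continuous f}.
Proof.
by case=> df _; apply: differentiable_continuous; apply/derivable1_diffP.
Qed.

(** * Bessel-Clifford functions: series, differential equation, bounds *)

Section BesselClifford.
Variable R : realType.
Implicit Types (k m n : nat) (t x : R).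

(* Coefficients of the k-th derivative of the Bessel-Clifford function. *)
Definition clifford_coeff k m : R := (-1) ^+ (m + k) / (m`!%:R * (m + k)`!%:R).

(** For t > 0, t^(k/2) times this function is (-1)^k J_k(2 sqrt t); [clifford 0] is the [g] of the
    overview. *)
Definition clifford k t : R := limn (pseries (clifford_coeff k) t).

Lemma factr_neq0 n : n`!%:R != 0 :> R.
Proof. by rewrite pnatr_eq0 -lt0n fact_gt0. Qed.

(** The factor m+1 produced by differentiation reduces (m+1)! to m!, so the family is closed under
    derivatives. *)
Lemma pseries_diffs_clifford_coeff k :
  pseries_diffs (clifford_coeff k) = clifford_coeff k.+1.
Proof.
apply/funext => m; rewrite /pseries_diffs /clifford_coeff addSnnS factS natrM.
by field; rewrite !factr_neq0 addrC natr1 pnatr_eq0.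
Qed.

(** Comparison with the exponential series of |t|, since (m+k)! >= 1. *)
Lemma is_cvg_pseries_clifford k t : cvgn (pseries (clifford_coeff k) t).
Proof.
apply: normed_cvg; apply: series_le_cvg (is_cvg_series_exp_coeff `|t|) => n //.
- exact: normr_ge0.
- exact: exp_coeff_ge0.
rewrite /exp_coeff /= normrM normrX mulrC ler_wpM2l ?exprn_ge0//.
rewrite /clifford_coeff normf_div normrX normrN1 expr1n div1r.
rewrite ger0_norm ?mulr_ge0// lef_pV2 ?posrE ?mulr_gt0 ?ltr0n ?fact_gt0//.
by rewrite ler_peMr// ler1n fact_gt0.
Qed.

Lemma is_derive_clifford k t : is_derive t 1 (clifford k) (clifford k.+1 t).
Proof.
rewrite /clifford -pseries_diffs_clifford_coeff.
(* Termwise differentiation needs convergence at some point of modulus larger than |t|. *)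
apply: (@pseries_snd_diffs _ _ (`|t| + 1));
  rewrite ?pseries_diffs_clifford_coeff; try exact: is_cvg_pseries_clifford.
by rewrite [ltRHS]ger0_norm ?addr_ge0// ltrDl.
Qed.

Lemma clifford_ode t : t * clifford 2 t + clifford 1 t + clifford 0 t = 0.
Proof.
(* The factor t raises degrees by one, so the other two sums take one more term; the combination
   then vanishes for every n, before any limit. *)
have H : (fun n => t * pseries (clifford_coeff 2) t n +
    pseries (clifford_coeff 1) t n.+1 + pseries (clifford_coeff 0) t n.+1) = cst 0.
  apply/funext => n; rewrite /pseries/= /series/=.
  elim: n => [|n IHn].
    rewrite big_nil !big_nat1 /clifford_coeff /= !expr0 mulr0 add0r addn1 addn0.
    by rewrite !fact0 expr1 !mulr1 mul1r invr1; lra.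
  rewrite big_nat_recr//= ![in X in _ + X + _]big_nat_recr//=.
  rewrite ![in X in _ + _ + X]big_nat_recr//=.
  rewrite -[RHS]IHn ![in X in _ = _ + X + _]big_nat_recr//=.
  rewrite ![in X in _ = _ + _ + X]big_nat_recr//=.
  (* Coefficient of t^(n+1): up to a common factor it is (n+1) + 1 - (n+2) = 0. *)
  suff : t * (clifford_coeff 2 n * t ^+ n) +
    clifford_coeff 1 n.+1 * t ^+ n.+1 + clifford_coeff 0 n.+1 * t ^+ n.+1 = 0.
    by move=> h; rewrite -[RHS]addr0 -h; ring.
  rewrite /clifford_coeff addn1 addn2 addn0 !factS !natrM !exprS.
  by field; rewrite !factr_neq0 -(natrD _ 2) [1 + _]addrC natr1 !pnatr_eq0.
have : (fun n => t * pseries (clifford_coeff 2) t n +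
    pseries (clifford_coeff 1) t n.+1 + pseries (clifford_coeff 0) t n.+1) @ \oo -->
    t * clifford 2 t + clifford 1 t + clifford 0 t.
  have C k : pseries (clifford_coeff k) t @ \oo --> clifford k t.
    exact: is_cvg_pseries_clifford.
  apply: cvgD; last by rewrite (cvg_shiftS (pseries _ t)); exact: C.
  apply: cvgD; last by rewrite (cvg_shiftS (pseries _ t)); exact: C.
  exact: cvgMr.
rewrite H => /cvg_lim <-//; exact: lim_cst.
Qed.

Lemma clifford0 k : clifford k 0 = (-1) ^+ k / k`!%:R.
Proof.
(* The shift discards the empty partial sum; all others equal the constant term. *)
rewrite /clifford /pseries; apply/cvg_lim => //; rewrite -cvg_shiftS.
rewrite (_ : (fun _ => _) = cst ((-1) ^+ k / k`!%:R)); first exact: cvg_cst.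
apply/funext => n; rewrite /series/= big_nat_recl//= big1 ?addr0.
  by rewrite /clifford_coeff add0n fact0 expr0 mulr1 mul1r.
by move=> i _; rewrite expr0n mulr0.
Qed.

Lemma besselJ0_clifford x : besselJ0 x = clifford 0 (x ^+ 2 / 4).
Proof.
rewrite /besselJ0 /clifford /pseries; congr (limn (series _)); apply/funext => m.
rewrite /clifford_coeff /= addn0 -expr2 exprM; congr (_ * _ ^+ _).
by rewrite expr_div_n; congr (_ / _); ring.
Qed.

(** The mean value point is interior, so the sign of [df] matters only at positive arguments. Each
    bound below applies this to an auxiliary function [E]. *)
Lemma ge0_is_derive_le (f df : R -> R) t : (forall x, is_derive x 1 f (df x)) ->
  (forall x, 0 < x -> 0 <= df x) -> 0 <= t -> f 0 <= f t.
Proof.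
move=> fdf df0; rewrite le_eqVlt => /predU1P[<-//|t0].
have [|c + h] := MVT t0 (fun x _ => fdf x).
  by apply: derivable_within_continuous => x _; exact: ex_derive.
rewrite in_itv/= => /andP[c0 _].
by rewrite -subr_ge0 h mulr_ge0 ?df0// subr0 ltW.
Qed.

(** The differential equation as a rewrite rule, letting [ring] verify derivatives of the functions
    [E]. *)
Lemma clifford0E t : clifford 0 t = - (t * clifford 2 t + clifford 1 t).
Proof. by apply/eqP; rewrite -addr_eq0 addrC clifford_ode. Qed.

Lemma norm_clifford0_le1 t : 0 <= t -> `|clifford 0 t| <= 1.
Proof.
move=> t0; rewrite -(@ler_pXn2r _ 2)// ?nnegrE// expr1n real_normK ?num_real//.
(* Minus the energy, hence nondecreasing; its value at 0 is -1. *)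
pose E (s : R) : R := - (clifford 0 s ^+ 2 + s * clifford 1 s ^+ 2).
have dE (s : R) : is_derive s 1 E (clifford 1 s ^+ 2).
  have d0 := is_derive_clifford 0 s; have d1 := is_derive_clifford 1 s.
  apply: is_derive_eq; rewrite /GRing.scale/= clifford0E; ring.
have := ge0_is_derive_le dE (fun s _ => sqr_ge0 _) t0.
rewrite /E !clifford0 fact0 expr0 => h.
have : 0 <= t * clifford 1 t ^+ 2 by rewrite mulr_ge0// sqr_ge0.
move: h; lra.
Qed.

Lemma clifford1_geN1 t : 0 <= t -> -1 <= clifford 1 t.
Proof.
(* The case t = 0 is separate because the main argument divides by t. *)
rewrite le_eqVlt => /predU1P[<-|t0]; first by rewrite clifford0 expr1 divr1.
(* Since (s g')' = - g, the derivative is 1 - g >= 0, and E t = t (g' t + 1). *)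
pose E (s : R) : R := s * clifford 1 s + s.
have dE (s : R) : is_derive s 1 E (1 - clifford 0 s).
  have d1 := is_derive_clifford 1 s.
  by apply: is_derive_eq; rewrite /GRing.scale/= clifford0E; ring.
have := ge0_is_derive_le dE _ (ltW t0).
rewrite /E mul0r add0r -[X in _ + X]mulr1 -mulrDr pmulr_rge0// addrC -lerBlDl sub0r.
apply=> s s0; rewrite subr_ge0 (le_trans (ler_norm _))//.
by rewrite norm_clifford0_le1// ltW.
Qed.

Lemma onem_clifford0_le t : 0 <= t -> 1 - clifford 0 t <= t.
Proof.
move=> t0; pose E (s : R) : R := clifford 0 s + s.
have dE (s : R) : is_derive s 1 E (clifford 1 s + 1).
  have d0 := is_derive_clifford 0 s.
  by apply: is_derive_eq.
have := ge0_is_derive_le dE _ t0.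
rewrite /E clifford0 expr0 fact0 divr1 addr0 lerBlDl; apply=> s s0.
by rewrite addrC -lerBlDl sub0r clifford1_geN1// ltW.
Qed.

Lemma clifford1_le t : 0 <= t -> clifford 1 t <= t - 1.
Proof.
rewrite le_eqVlt => /predU1P[<-|t0].
  by rewrite clifford0 expr1 divr1 sub0r.
(* The derivative 2s - (1 - g) is split so that its second summand is nonnegative by
   [onem_clifford0_le]. *)
pose E (s : R) : R := s ^+ 2 - (s * clifford 1 s + s).
have dE (s : R) : is_derive s 1 E (s + (s - (1 - clifford 0 s))).
  have d1 := is_derive_clifford 1 s.
  by apply: is_derive_eq; rewrite /GRing.scale/= clifford0E; ring.
have := ge0_is_derive_le dE _ (ltW t0).
have -> : E 0 = 0 by rewrite /E; ring.
have -> : E t = t * (t - (clifford 1 t + 1)) by rewrite /E; ring.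
rewrite pmulr_rge0// subr_ge0 -lerBrDr; apply=> s s0.
by rewrite addr_ge0 ?subr_ge0 ?onem_clifford0_le// ltW.
Qed.

Lemma onem_clifford0_ge t : 0 <= t -> t - t ^+ 2 <= 1 - clifford 0 t.
Proof.
move=> t0; pose E (s : R) : R := s ^+ 2 - s - clifford 0 s.
have dE (s : R) : is_derive s 1 E (s + (s - 1 - clifford 1 s)).
  have d0 := is_derive_clifford 0 s.
  by apply: is_derive_eq; rewrite /GRing.scale/=; ring.
have := ge0_is_derive_le dE _ t0.
rewrite /E clifford0 expr0 fact0 divr1 => h.
suff : forall x, 0 < x -> 0 <= x + (x - 1 - clifford 1 x).
  by move=> /h; lra.
by move=> x x0; rewrite addr_ge0 ?subr_ge0 ?clifford1_le// ltW.
Qed.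

(** * Bounds and continuity of J0 *)

Lemma norm_besselJ0_le1 x : `|besselJ0 x| <= 1.
Proof. by rewrite besselJ0_clifford norm_clifford0_le1// divr_ge0// sqr_ge0. Qed.

Lemma onem_besselJ0_le x : 1 - besselJ0 x <= x ^+ 2 / 4.
Proof.
by rewrite besselJ0_clifford onem_clifford0_le// divr_ge0// sqr_ge0.
Qed.

Lemma onem_besselJ0_ge x :
  x ^+ 2 / 4 * (1 - x ^+ 2 / 4) <= 1 - besselJ0 x.
Proof.
rewrite besselJ0_clifford mulrBr mulr1 -expr2 onem_clifford0_ge//.
by rewrite divr_ge0// sqr_ge0.
Qed.

Lemma continuous_besselJ0 : continuous (@besselJ0 R).
Proof.
rewrite (_ : @besselJ0 R = clifford 0 \o (fun x => x ^+ 2 / 4)); last first.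
  by apply/funext => x; exact: besselJ0_clifford.
move=> x; apply: continuous_comp.
  by apply: cvgMl; exact: exprn_continuous.
exact: is_derive_continuous (is_derive_clifford 0 _).
Qed.

End BesselClifford.

(** * Improper integrals, rescaling and powers *)

Section Integrals.
Variable R : realType.
Implicit Types (a b c p x : R) (f : R -> R).
Local Notation mu := (@lebesgue_measure R).

Lemma continuous_powR p x : 0 < x -> {for x, continuous (@powR R ^~ p)}.
Proof.
by move=> x0; apply: is_derive_continuous (is_derive1_powR p x0).
Qed.

Lemma in_continuous_within (A : set R) f :
  (forall x, A x -> {for x, continuous f}) -> {within A, continuous f}.
Proof.
by move=> cf; apply: continuous_in_subspaceT => x /set_mem; exact: cf.
Qed.

(** Monotone convergence along compact intervals exhausting []0, c]], which keeps away from a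
    singularity at 0. *)
Lemma cvg_ge0_integral_itv0c c f : 0 < c ->
  (forall x, 0 < x -> 0 <= f x) -> (forall x, 0 < x -> {for x, continuous f}) ->
  (\int[mu]_(x in `[(c / n.+1%:R)%R, c]) (f x)%:E)%E @[n --> \oo] -->
  (\int[mu]_(x in `]0%R, c]) (f x)%:E)%E.
Proof.
move=> c0 f0 cf.
have -> : `]0%R, c]%classic = \bigcup_n `[c / n.+1%:R, c]%classic.
  apply/seteqP; split => [x|x [n _]] /=; rewrite !in_itv/= => /andP[x0 xc].
    (* Archimedean choice of n with 1/(n+1) < x/c. *)
    have [n cn] := ltr_add_invr (divr_gt0 x0 c0).
    exists n => //=; rewrite in_itv/= xc andbT.
    by move: cn; rewrite add0r ltr_pdivlMr// mulrC => /ltW.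
  by rewrite xc (lt_le_trans _ x0)// divr_gt0.
have sub (n : nat) (x : R) : [set` `[c / n.+1%:R, c]] x -> 0 < x.
  by rewrite /= in_itv/= => /andP[+ _]; apply: lt_le_trans; rewrite divr_gt0.
apply: ge0_nondecreasing_set_cvg_integral => //.
- move=> m n mn; apply/subsetPset => x/=; rewrite !in_itv/= => /andP[+ ->].
  rewrite andbT; apply: le_trans.
  by rewrite ler_pM2l// lef_pV2 ?posrE// ler_nat ltnS.
- move=> n; apply/measurable_EFinP.
  apply: subspace_continuous_measurable_fun => //.
  by apply: in_continuous_within => x /sub; exact: cf.
- by move=> n x /sub x0; rewrite lee_fin f0.
Qed.

(** The substitution is made on the compact intervals, where [f] is continuous, and both sides pass
    to the limit. *)
Lemma ge0_integral_itv0c_scale c f : 0 < c ->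
  (forall x, 0 < x -> 0 <= f x) -> (forall x, 0 < x -> {for x, continuous f}) ->
  (\int[mu]_(x in `]0%R, c]) (f x)%:E =
   \int[mu]_(x in `]0%R, 1%R]) (c * f (c * x))%:E)%E.
Proof.
move=> c0 f0 cf.
have cfc x : 0 < x -> {for x, continuous (fun x => c * f (c * x))}.
  move=> x0; apply: cvgMr; apply: (@continuous_comp _ _ _ (fun x => c * x) f).
    exact: mulrl_continuous.
  by apply: cf; rewrite mulr_gt0.
have f0c x : 0 < x -> 0 <= c * f (c * x).
  by move=> x0; rewrite mulr_ge0 ?f0 ?mulr_gt0// ltW.
rewrite -(cvg_lim _ (cvg_ge0_integral_itv0c c0 f0 cf))//.
apply/cvg_lim => //; rewrite (_ : (fun _ => _) =
  (fun n => \int[mu]_(x in `[(1 / n.+1%:R)%R, 1%R]) (c * f (c * x))%:E)%E).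
  exact: (cvg_ge0_integral_itv0c ltr01 f0c cfc).
apply/funext => n.
have dc : derive1 (fun x : R => c * x) = cst c.
  apply/funext => x; rewrite derive1E (@deriveZ _ _ _ id)//.
  by rewrite derive_id /GRing.scale/= mulr1.
have := @integration_by_substitution_increasing R (fun x => c * x) f (1 / n.+1%:R) 1.
rewrite mulr1 mul1r dc => ->.
- by apply: eq_integral => x _; rewrite /= mulrC.
- by rewrite invf_le1// ler1n.
- by move=> x y _ _ xy; rewrite ltr_pM2l.
- by move=> x _; exact: cst_continuous.
- exact: is_cvg_cst.
- exact: is_cvg_cst.
- split => //.
  + by apply: cvg_at_right_filter; exact: mulrl_continuous.
  + by apply: cvg_at_left_filter; exact: mulrl_continuous.
- apply: in_continuous_within => x /=; rewrite in_itv/= => /andP[+ _].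
  by move=> h; apply: cf; rewrite (lt_le_trans _ h)// divr_gt0.
Qed.

Lemma integral_powR_itv0c p c : 0 < p -> 0 < c ->
  (\int[mu]_(x in `]0%R, c]) (x `^ (p - 1))%:E = (c `^ p / p)%:E)%E.
Proof.
move=> p0 c0.
have /cvg_lim <- // := @cvg_ge0_integral_itv0c c (fun x => x `^ (p - 1)) c0
  (fun x _ => powR_ge0 _ _) (@continuous_powR _).
apply/cvg_lim => //.
have dF x : 0 < x -> is_derive x 1 (fun y => y `^ p / p) (x `^ (p - 1)).
  move=> x0; have d := is_derive1_powR p x0.
  apply: is_derive_eq; rewrite /GRing.scale/=; field; exact: lt0r_neq0.
have cF x : 0 < x -> {for x, continuous (fun y => y `^ p / p)}.
  by move=> /dF; exact: is_derive_continuous.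
(* For n = 0 the interval is the single point c, while the fundamental theorem needs distinct
   endpoints; hence the shift. *)
rewrite -cvg_shiftS (_ : (fun _ => _) =
  (fun n => (c `^ p / p - (c / n.+2%:R) `^ p / p)%:E)); last first.
  apply/funext => n.
  rewrite (@continuous_FTC2 _ _ (fun x => x `^ p / p))//.
  - by rewrite ltr_pdivrMr// ltr_pMr// ltr1n.
  - apply: in_continuous_within => x; rewrite /= in_itv/= => /andP[h _].
    by apply: continuous_powR; rewrite (lt_le_trans _ h)// divr_gt0.
  - split.
    + move=> x; rewrite in_itv/= => /andP[h _].
      by have := dF x (lt_trans (divr_gt0 c0 (ltr0Sn _ _)) h) => d; exact: ex_derive.
    + by apply: cvg_at_right_filter; apply: cF; rewrite divr_gt0.
    + by apply: cvg_at_left_filter; apply: cF.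
  - move=> x; rewrite in_itv/= => /andP[h _]; rewrite derive1E.
    by have := dF x (lt_trans (divr_gt0 c0 (ltr0Sn _ _)) h) => d; exact: derive_val.
apply: cvg_EFin; first exact: nearW.
rewrite -[X in _ --> X]subr0; apply: cvgB; first exact: cvg_cst.
rewrite -(mul0r p^-1); apply: cvgMl.
have : c / n.+2%:R @[n --> \oo] --> 0.
  rewrite -(mulr0 c); apply: cvgMr.
  by rewrite (@cvg_shiftS _ (@harmonic R)); exact: cvg_harmonic.
move=> h; move/cvg_at_rightP : (powR_cvg0 p0); apply; split=> // n.
by rewrite divr_gt0.
Qed.

Lemma cvgy_powR0 p : p < 0 -> x `^ p @[x --> +oo] --> (0 : R).
Proof.
move=> p0; apply/cvgr0Pnorm_lt => e e0; near=> x.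
have x0 : 0 < x by [].
rewrite ger0_norm ?powR_ge0// -[p]opprK powRN invf_plt ?posrE ?powR_gt0//.
(* As - p > 0, this rewriting turns the goal into x > e^(1/p), which holds eventually. *)
have -> : e^-1 = (e `^ (p^-1)) `^ (- p).
  by rewrite -powRrM mulrN mulVf ?ltr0_neq0// powR_inv1// ltW.
rewrite gt0_ltr_powR ?oppr_gt0// ?nnegrE ?powR_ge0 ?ltW//.
Unshelve. all: end_near. Qed.

Lemma integral_powR_itvy p a : p < 0 -> 0 < a ->
  (\int[mu]_(x in `[a, +oo[) (x `^ (p - 1))%:E = (- (a `^ p / p))%:E)%E.
Proof.
move=> p0 a0.
have dF x : 0 < x -> is_derive x 1 (fun y => y `^ p / p) (x `^ (p - 1)).
  move=> x0; have d := is_derive1_powR p x0.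
  apply: is_derive_eq; rewrite /GRing.scale/=; field; exact: ltr0_neq0.
rewrite (@ge0_continuous_FTC2y _ _ (fun x => x `^ p / p) _ 0).
- by rewrite -EFinB sub0r.
- by move=> x _; exact: powR_ge0.
- apply: in_continuous_within => x; rewrite /= in_itv/= andbT => h.
  by apply: continuous_powR; rewrite (lt_le_trans _ h).
- by rewrite -(mul0r p^-1); apply: cvgMl; exact: cvgy_powR0.
- by move=> x ax; have := dF x (lt_trans a0 ax) => d; exact: ex_derive.
- by apply: cvg_at_right_filter; apply: is_derive_continuous (dF _ a0).
- move=> x; rewrite in_itv/= andbT => ax; rewrite derive1E.
  by have := dF x (lt_trans a0 ax) => d; exact: derive_val.
Qed.

Lemma integrable_powR_itv0c p c : 0 < p -> 0 < c ->
  mu.-integrable `]0, c] (EFin \o (@powR R ^~ (p - 1))).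
Proof.
move=> p0 c0; apply/integrableP; split.
  by apply/measurable_EFinP; apply: measurable_funTS; exact: measurable_powR.
under eq_integral do rewrite /= ger0_norm ?powR_ge0//.
by rewrite integral_powR_itv0c// ltry.
Qed.

Lemma integrable_powR_itvy p a : p < 0 -> 0 < a ->
  mu.-integrable `[a, +oo[ (EFin \o (@powR R ^~ (p - 1))).
Proof.
move=> p0 a0; apply/integrableP; split.
  by apply/measurable_EFinP; apply: measurable_funTS; exact: measurable_powR.
under eq_integral do rewrite /= ger0_norm ?powR_ge0//.
by rewrite integral_powR_itvy// ltry.
Qed.

End Integrals.

(** * Bounds and integrability of the kernel *)

Section BesselKernel.
Variables (R : realType) (alpha : R).
Hypotheses (alpha_gt0 : 0 < alpha) (alpha_lt1 : alpha < 1).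
Implicit Types c t x z : R.
Local Notation mu := (@lebesgue_measure R).

Definition bessel_kernel x : R := (1 - besselJ0 x) / x `^ (1 + 2 * alpha).
Local Notation h := bessel_kernel.

Lemma bessel_kernel_ge0 x : 0 <= h x.
Proof.
rewrite divr_ge0 ?powR_ge0// subr_ge0.
by rewrite (le_trans (ler_norm _))// norm_besselJ0_le1.
Qed.

Lemma continuous_bessel_kernel x : 0 < x -> {for x, continuous h}.
Proof.
move=> x0; apply: cvgM.
  by apply: cvgB; [exact: cvg_cst | exact: continuous_besselJ0].
apply: cvgV; first by rewrite gt_eqF// powR_gt0.
exact: continuous_powR.
Qed.

(** The exponent 1 - 2 alpha is kept as p - 1 with p = 2(1 - alpha), the shape used by
    [integral_powR_itv0c]. *)
Lemma powR_sqr_div x : 0 < x ->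
  x `^ (2 * (1 - alpha) - 1) = x ^+ 2 / x `^ (1 + 2 * alpha).
Proof.
move=> x0; rewrite (_ : _ - 1 = 2%:R - (1 + 2 * alpha)); last by ring.
by rewrite powRB ?(gt_eqF x0) ?implybT// powR_mulrn// ltW.
Qed.

Lemma bessel_kernel_le_sqr x : 0 < x ->
  h x <= 4^-1 * x `^ (2 * (1 - alpha) - 1).
Proof.
move=> x0; rewrite powR_sqr_div// mulrCA mulrA ler_wpM2r ?invr_ge0 ?powR_ge0//.
exact: onem_besselJ0_le.
Qed.

(** Replacing x^2/4 by c^2/4 in the correction factor makes the lower bound a constant times a
    power; for c > 2 that constant is negative. *)
Lemma bessel_kernel_ge_sqr c x : 0 < x -> x <= c ->
  (1 - c ^+ 2 / 4) / 4 * x `^ (2 * (1 - alpha) - 1) <= h x.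
Proof.
move=> x0 xc; rewrite powR_sqr_div// mulrA ler_wpM2r ?invr_ge0 ?powR_ge0//.
apply: le_trans (onem_besselJ0_ge x).
rewrite (_ : _ / 4 * _ = x ^+ 2 / 4 * (1 - c ^+ 2 / 4)); last by ring.
rewrite ler_wpM2l ?divr_ge0 ?sqr_ge0// lerB// ler_wpM2r//.
by rewrite ler_pXn2r ?nnegrE// ltW// (lt_le_trans x0).
Qed.

Lemma bessel_kernel_le x : h x <= 2 * x `^ (- (2 * alpha) - 1).
Proof.
rewrite /h (_ : _ - 1 = - (1 + 2 * alpha)); last by ring.
rewrite powRN ler_wpM2r ?invr_ge0 ?powR_ge0//.
have := norm_besselJ0_le1 x; rewrite ler_norml => /andP[? _]; lra.
Qed.

Lemma measurable_bessel_kernel (A : set R) : measurable_fun A h.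
Proof.
apply: measurable_funTS; apply: measurable_funM.
  apply: measurable_funB => //.
  by apply: continuous_measurable_fun; exact: continuous_besselJ0.
by under eq_fun do rewrite -powRN; exact: measurable_powR.
Qed.

Let p_gt0 : 0 < 2 * (1 - alpha).
Proof. by rewrite mulr_gt0// subr_gt0. Qed.

Let p_lt0 : - (2 * alpha) < 0.
Proof. by rewrite oppr_lt0 mulr_gt0. Qed.

(** Dominated by a multiple of x^(1 - 2 alpha), integrable near 0 because alpha < 1. *)
Lemma integrable_bessel_kernel_itv0c c : 0 < c ->
  mu.-integrable `]0, c] (EFin \o h).
Proof.
move=> c0; have ip := integrable_powR_itv0c p_gt0 c0.
apply: le_integrable (integrableZl _ 4^-1 ip) => //.
  by apply/measurable_EFinP; exact: measurable_bessel_kernel.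
move=> x /=; rewrite in_itv/= => /andP[x0 _].
rewrite lee_fin !ger0_norm ?bessel_kernel_ge0 ?mulr_ge0 ?powR_ge0//.
exact: bessel_kernel_le_sqr.
Qed.

(** Dominated by 2 x^(-1 - 2 alpha), integrable at infinity because alpha > 0. *)
Lemma integrable_bessel_kernel_itvy c : 0 < c ->
  mu.-integrable `[c, +oo[ (EFin \o h).
Proof.
move=> c0; have ip := integrable_powR_itvy p_lt0 c0.
apply: le_integrable (integrableZl _ 2 ip) => //.
  by apply/measurable_EFinP; exact: measurable_bessel_kernel.
move=> x /= _.
rewrite lee_fin !ger0_norm ?bessel_kernel_ge0 ?mulr_ge0 ?powR_ge0//.
exact: bessel_kernel_le.
Qed.

Lemma integrable_bessel_kernel : mu.-integrable `]0, +oo[ (EFin \o h).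
Proof.
have mh A : measurable_fun A (EFin \o h).
  by apply/measurable_EFinP; exact: measurable_bessel_kernel.
have [_ i1] := integrableP _ _ _ (integrable_bessel_kernel_itv0c ltr01).
have /integrableP[_ i2] : mu.-integrable `]1, +oo[ (EFin \o h).
  apply: integrableS (integrable_bessel_kernel_itvy ltr01) => //.
  by apply: subset_itvr; rewrite bnd_simp.
apply/integrableP; split; first exact: mh.
rewrite (@itv_bndbnd_setU _ _ _ (BRight 1)) ?bnd_simp//.
rewrite ge0_integral_setU//=.
- exact: lte_add_pinfty.
- apply/measurable_EFinP; apply: measurableT_comp => //.
  exact: measurable_bessel_kernel.
- apply/disj_setPS => x [] /=; rewrite !in_itv/= => /andP[_ x1] /andP[+ _].
  by rewrite ltNge x1.
Qed.

(** * The truncated integral, [H] in the overview: asymptotics and rescaling *)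

Definition bessel_integral c : R := \int[mu]_(x in `]0, c]) h x.

Lemma bessel_integral_le c : 0 < c ->
  bessel_integral c <= c `^ (2 * (1 - alpha)) / (8 * (1 - alpha)).
Proof.
move=> c0; have ip := integrable_powR_itv0c p_gt0 c0.
(* Here 8(1 - alpha) = 4p: 1/4 comes from the Bessel bound, 1/p from integrating the power. *)
rewrite (_ : _ / _ = 4^-1 * (c `^ (2 * (1 - alpha)) / (2 * (1 - alpha)))); last first.
  by field; rewrite gt_eqF// subr_gt0.
have -> : c `^ (2 * (1 - alpha)) / (2 * (1 - alpha)) =
    \int[mu]_(x in `]0, c]) x `^ (2 * (1 - alpha) - 1).
  by rewrite /Rintegral integral_powR_itv0c.
rewrite -RintegralZl//; apply: le_Rintegral => //.
- exact: integrable_bessel_kernel_itv0c.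
- by apply: (integrableZl _ 4^-1 ip).
- move=> x /=; rewrite in_itv/= => /andP[x0 _]; exact: bessel_kernel_le_sqr.
Qed.

Lemma bessel_integral_ge c : 0 < c ->
  (1 - c ^+ 2 / 4) * (c `^ (2 * (1 - alpha)) / (8 * (1 - alpha))) <=
  bessel_integral c.
Proof.
move=> c0; have ip := integrable_powR_itv0c p_gt0 c0.
rewrite (_ : _ * (_ / _) = (1 - c ^+ 2 / 4) / 4 *
    (c `^ (2 * (1 - alpha)) / (2 * (1 - alpha)))); last first.
  by field; rewrite gt_eqF// subr_gt0.
have -> : c `^ (2 * (1 - alpha)) / (2 * (1 - alpha)) =
    \int[mu]_(x in `]0, c]) x `^ (2 * (1 - alpha) - 1).
  by rewrite /Rintegral integral_powR_itv0c.
rewrite -RintegralZl//; apply: le_Rintegral => //.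
- by apply: (integrableZl _ ((1 - c ^+ 2 / 4) / 4) ip).
- exact: integrable_bessel_kernel_itv0c.
- move=> x /=; rewrite in_itv/= => /andP[x0 xc]; exact: bessel_kernel_ge_sqr.
Qed.

Lemma cvg_bessel_integral : bessel_integral c @[c --> +oo] -->
  \int[mu]_(x in `]0, +oo[) h x.
Proof.
set l := \int[mu]_(x in _) _.
(* The difference is the integral over []c, +oo[], at most 2 c^(-2 alpha) / (2 alpha). *)
have tail c : 0 < c -> 0 <= l - bessel_integral c <= c `^ (- (2 * alpha)) / alpha.
  move=> c0; rewrite /l /bessel_integral Rintegral_itvB ?bnd_simp ?(ltW c0)//; last first.
    exact: integrable_bessel_kernel.
  have ih : mu.-integrable `]c, +oo[ (EFin \o h).
    apply: integrableS (integrable_bessel_kernel_itvy c0) => //.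
    by apply: subset_itvr; rewrite bnd_simp.
  rewrite Rintegral_ge0/=; last by move=> x _; exact: bessel_kernel_ge0.
  rewrite Rintegral_itv_obnd_cbnd//.
  have ip := integrable_powR_itvy p_lt0 c0.
  rewrite (_ : _ / alpha = 2 * - (c `^ (- (2 * alpha)) / (- (2 * alpha)))); last first.
    by field; rewrite gt_eqF.
  have -> : - (c `^ (- (2 * alpha)) / (- (2 * alpha))) =
      \int[mu]_(x in `[c, +oo[) x `^ (- (2 * alpha) - 1).
    by rewrite /Rintegral integral_powR_itvy.
  rewrite -RintegralZl//; apply: le_Rintegral => //.
  - exact: integrable_bessel_kernel_itvy.
  - by apply: (integrableZl _ 2 ip).
  - by move=> x _; exact: bessel_kernel_le.
apply: (@squeeze_cvgr _ _ _ _ (fun c => l - c `^ (- (2 * alpha)) / alpha) (cst l)).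
- by near=> c; have := tail c; move=> /(_ _)/andP[]; [by [] |rewrite /cst; lra].
- rewrite -[X in _ --> X]subr0; apply: cvgB; first exact: cvg_cst.
  by rewrite -(mul0r alpha^-1); apply: cvgMl; exact: cvgy_powR0.
- exact: cvg_cst.
Unshelve. all: end_near. Qed.

(** Of the factor c^(1 + 2 alpha), one c stays inside as the Jacobian of tau = c z. *)
Lemma scaled_kernel c z : 0 < c -> 0 < z ->
  (1 - besselJ0 (c * z)) / z `^ (1 + 2 * alpha) =
  c `^ (2 * alpha) * (c * h (c * z)).
Proof.
move=> c0 z0; rewrite /h powRM ?ltW// (@powRD _ c) ?(gt_eqF c0) ?implybT//.
rewrite powRr1 ?ltW//; field.
by rewrite !gt_eqF ?powR_gt0.
Qed.

(** Rescaling identifies its integral with that of the kernel over []0, c]], which is finite. *)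
Lemma integrable_scaled_kernel c : 0 < c ->
  mu.-integrable `]0, 1] (fun z => (c * h (c * z))%:E).
Proof.
move=> c0; apply/integrableP; split.
  apply/measurable_EFinP; apply: measurable_funM => //.
  apply: measurableT_comp; first exact: measurable_bessel_kernel.
  exact: measurable_funM.
have ch0 z : 0 <= c * h (c * z) by rewrite mulr_ge0 ?bessel_kernel_ge0// ltW.
under eq_integral do rewrite gee0_abs ?lee_fin ?ch0//.
rewrite -ge0_integral_itv0c_scale//.
- have /integrableP[_] := integrable_bessel_kernel_itv0c c0.
  by under eq_integral do rewrite /= ger0_norm ?bessel_kernel_ge0//.
- by move=> x _; exact: bessel_kernel_ge0.
- exact: continuous_bessel_kernel.
Qed.

Lemma Rintegral_scaled_kernel c : 0 < c ->
  \int[mu]_(z in `]0, 1]) ((1 - besselJ0 (c * z)) / z `^ (1 + 2 * alpha)) =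
  c `^ (2 * alpha) * bessel_integral c.
Proof.
move=> c0.
transitivity (\int[mu]_(z in `]0, 1]) (c `^ (2 * alpha) * (c * h (c * z)))).
  apply: eq_Rintegral => z; rewrite inE/= in_itv/= => /andP[z0 _].
  exact: scaled_kernel.
rewrite RintegralZl//; last exact: integrable_scaled_kernel.
congr (_ * fine _); rewrite -ge0_integral_itv0c_scale//.
- by move=> x _; exact: bessel_kernel_ge0.
- exact: continuous_bessel_kernel.
Qed.

End BesselKernel.

(** * The two limits of the dispersion relation *)

(* A divergent real-valued integral of a nonnegative function is 0 by convention;
   the first two conjuncts state that the integrals below do converge. *)
Theorem theorem2p2 (R : realType) (kappa rho delta alpha : R)
  (kappa_gt0 : 0 < kappa) (rho_gt0 : 0 < rho) (delta_gt0 : 0 < delta)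
  (alpha_gt0 : 0 < alpha) (alpha_lt1 : alpha < 1) :
  [/\ forall xi : R, 0 < xi ->
        lebesgue_measure.-integrable `]0, 1] (fun z : R =>
          ((1 - besselJ0 (xi * delta * z)) / z `^ (1 + 2 * alpha))%:E),
      lebesgue_measure.-integrable `]0, +oo[ (fun tau : R =>
        ((1 - besselJ0 tau) / tau `^ (1 + 2 * alpha))%:E),
      xi ^- 2 * omega kappa rho delta alpha xi ^+ 2 @[xi --> (0 : R)^'+] -->
        pi * kappa * delta `^ (2 * (1 - alpha)) / (2 * (1 - alpha) * rho)
    & xi `^ (- (2 * alpha)) * omega kappa rho delta alpha xi ^+ 2
        @[xi --> +oo] -->
        4 * pi * kappa / rho *
        \int[lebesgue_measure]_(tau in `]0, +oo[)
          ((1 - besselJ0 tau) / tau `^ (1 + 2 * alpha))].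
Proof.
have a1 : 0 < 1 - alpha by rewrite subr_gt0.
have pik : 0 < 4 * pi * kappa / rho by rewrite divr_gt0// !mulr_gt0// pi_gt0.
(* The radicand is nonnegative, so squaring removes the root; delta^(2 alpha) cancels. *)
have omegaE (xi : R) : 0 < xi -> omega kappa rho delta alpha xi ^+ 2 =
    4 * pi * kappa / rho *
    (xi `^ (2 * alpha) * bessel_integral alpha (xi * delta)).
  move=> xi0; rewrite /omega Rintegral_scaled_kernel ?mulr_gt0// sqr_sqrtr.
    rewrite powRM ?ltW//; field.
    by rewrite !gt_eqF ?powR_gt0.
  rewrite mulr_ge0//.
    by rewrite divr_ge0 ?mulr_ge0 ?powR_ge0 ?pi_ge0 ?ltW.
  by rewrite mulr_ge0 ?powR_ge0// Rintegral_ge0// => x _; exact: bessel_kernel_ge0.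
split.
- move=> xi xi0; have c0 : 0 < xi * delta by rewrite mulr_gt0.
  have ik := integrable_scaled_kernel alpha_lt1 c0.
  apply: eq_integrable (integrableZl _ ((xi * delta) `^ (2 * alpha)) ik) => //.
  move=> z; rewrite inE/= in_itv/= => /andP[z0 _].
  by rewrite scaled_kernel.
- exact: integrable_bessel_kernel.
- set L := (X in _ --> X).
  apply: (@squeeze_cvgr _ _ _ _ (fun xi => (1 - (xi * delta) ^+ 2 / 4) * L) (cst L)).
  + near=> xi; have xi0 : 0 < xi by [].
    have c0 : 0 < xi * delta by rewrite mulr_gt0.
    rewrite omegaE//.
    have e : xi ^- 2 * xi `^ (2 * alpha) = (xi `^ (2 * (1 - alpha)))^-1.
      rewrite mulrBr mulr1 powRB ?(gt_eqF xi0) ?implybT//.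
      by rewrite (powR_mulrn 2) ?ltW// invf_div mulrC.
    (* The factor for which xi^(-2) omega^2 = k H(xi delta). *)
    pose k := 4 * pi * kappa / rho * (xi ^- 2 * xi `^ (2 * alpha)).
    have k0 : 0 <= k.
      by rewrite mulr_ge0 ?(ltW pik)// mulr_ge0 ?powR_ge0// invr_ge0 sqr_ge0.
    (* The upper bound for H(xi delta), times k, does not depend on xi: it is exactly the limit. *)
    have -> : L = k * ((xi * delta) `^ (2 * (1 - alpha)) / (8 * (1 - alpha))).
      rewrite /k e powRM ?ltW// /L; field.
      by rewrite !gt_eqF ?powR_gt0.
    rewrite (_ : xi ^- 2 * _ = k * bessel_integral alpha (xi * delta)); last first.
      by rewrite /k; ring.
    by rewrite mulrCA !ler_wpM2l ?bessel_integral_ge ?bessel_integral_le.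
  + rewrite -[X in _ --> X]mul1r; apply: cvgMl.
    rewrite -[X in _ --> X]subr0; apply: cvgB; first exact: cvg_cst.
    apply: cvg_at_right_filter.
    have m : xi * delta @[xi --> (0 : R)] --> 0 * delta.
      exact: mulrr_continuous.
    suff : (xi * delta) ^+ 2 / 4 @[xi --> (0 : R)] --> 0 * delta * (0 * delta) / 4.
      by rewrite !mul0r.
    by apply: cvgMl; exact: (cvgM m m).
  + exact: cvg_cst.
(* For xi > 0 the powers of xi cancel exactly, leaving a constant times H(xi delta). *)
- apply: (@cvg_trans _ (4 * pi * kappa / rho * bessel_integral alpha (xi * delta)
    @[xi --> +oo])).
    apply: near_eq_cvg; near=> xi; have xi0 : 0 < xi by [].
    rewrite omegaE// powRN; field.
    by rewrite !gt_eqF ?powR_gt0.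
  apply: cvgMr; apply: cvg_comp (cvg_bessel_integral alpha_gt0 alpha_lt1).
  exact: (gt0_cvgMly delta_gt0 cvg_id).
Unshelve. all: end_near. Qed.
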